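(* Let $k,r\ge0$ be integers, $\mathcal J=(j_0,\dots,j_r)$ a strictly increasing sequence of integers with $j_0=0$, $n=j_r+k+1$, $t_{0:n}$ a non-decreasing sequence of real knots, and $\xi\in\mathbb R$. Define the $(r+1)\times(r+1)$ matrices $$M:=\Big[\sum_{|\omega|=\delta}t_{j:j+k+1}^{\,\omega}\Big]_{\delta=0,\dots,r,\ j\in\mathcal J},\qquad M_\xi:=\Big[\sum_{|\omega|=\delta}(t_{j:j+k+1}+\xi)^{\omega}\Big]_{\delta=0,\dots,r,\ j\in\mathcal J}.$$ Then $M_\xi=P_{k,r}(\xi)\,M$, where $P_{k,r}(\xi)$ is the $(r+1)\times(r+1)$ lower triangular matrix with entries $\binom{\delta+k+1}{\delta-i}\xi^{\delta-i}$ in row $\delta$ and column $i$ for $0\le i\le\delta\le r$, and zeros above the diagonal, i.e. $$P_{k,r}(\xi)=\begin{bmatrix}1\\ \binom{1+k+1}{1}\xi&1\\ \vdots&\vdots&\ddots\\ \binom{r+k+1}{r}\xi^r&\cdots&\binom{r+k+1}{1}\xi&1\end{bmatrix}.$$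
   Context: $t_{j:j+k+1}=(t_j,\dots,t_{j+k+1})$, and $t_{j:j+k+1}+\xi$ adds $\xi$ to each entry. Multi-index notation: for $\omega=(\omega_0,\dots,\omega_{k+1})$ with nonnegative integer entries, $|\omega|=\sum_i\omega_i$ and $v^\omega=v_0^{\omega_0}\cdots v_{k+1}^{\omega_{k+1}}$ for $v\in\mathbb R^{k+2}$; the sums run over all such $\omega$ with $|\omega|=\delta$ (with $v^\omega=1$ for $\omega=0$). *)

(* Defs.v *)
From mathcomp Require Import all_boot all_order all_algebra.
From mathcomp Require Import reals.
Set Implicit Arguments.
Unset Strict Implicit.
Unset Printing Implicit Defensive.
Import Order.TTheory GRing.Theory Num.Theory.
Local Open Scope ring_scope.

(* Multi-indices of length m with entries at most d. Every multi-index with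
   |w| = d has entries at most d, so this finite type contains all of the
   multi-indices summed over in [chomog]. *)
Definition mindex (m d : nat) := {ffun 'I_m -> 'I_d.+1}.

Definition mabs (m d : nat) (w : mindex m d) : nat := (\sum_i w i)%N.

(* v ^ w; in particular 0 ^+ 0 = 1. *)
Definition mpow (R : realType) (m d : nat) (v : 'rV[R]_m) (w : mindex m d) : R :=
  \prod_i v ord0 i ^+ w i.

(* The complete homogeneous symmetric polynomial of degree d at v. *)
Definition chomog (R : realType) (m d : nat) (v : 'rV[R]_m) : R :=
  \sum_(w : mindex m d | mabs w == d) mpow v w.

(* t_{j:j+k+1} = (t_j, ..., t_{j+k+1}), which has k + 2 entries. *)
Definition window (R : realType) (k : nat) (t : nat -> R) (j : nat) : 'rV[R]_k.+2 :=
  \row_i t (j + i)%N.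

Definition Mmat (R : realType) (k r : nat) (J : 'I_r.+1 -> nat) (t : nat -> R)
    : 'M[R]_r.+1 :=
  \matrix_(d < r.+1, l < r.+1) chomog d (window k t (J l)).

Definition Mmat_shift (R : realType) (k r : nat) (J : 'I_r.+1 -> nat)
    (t : nat -> R) (xi : R) : 'M[R]_r.+1 :=
  \matrix_(d < r.+1, l < r.+1) chomog d (window k t (J l) + const_mx xi).

Definition Pmat (R : realType) (k r : nat) (xi : R) : 'M[R]_r.+1 :=
  \matrix_(d < r.+1, i < r.+1)
    if (i <= d)%N then 'C((d + k + 1)%N, (d - i)%N)%:R * xi ^+ (d - i) else 0.

(* Main.v *)
Require Import Defs.
From mathcomp Require Import all_boot all_order all_algebra.
From mathcomp Require Import reals.
From mathcomp Require Import ring.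
Import Order.TTheory GRing.Theory Num.Theory.
Local Open Scope ring_scope.

(** Entry by entry, the matrix identity is the translation formula
    [h_d(v + xi) = \sum_(i <= d) 'C(d + m - 1, d - i) xi^(d - i) h_i(v)]
    for the complete homogeneous symmetric polynomials [h_d] in [m] variables,
    taken at [m = k + 2]. It is proved by a double induction on the number of
    variables and on the degree. The induction runs on the recurrence
    [h_(d+1)(x, v) = h_(d+1)(v) + x h_d(x, v)], which separates the monomials
    according to whether they contain [x] ([hsym_rec]): applied to the
    translated variables it produces, once [h_i(v) + x h_(i-1)(x, v)] has been
    reassembled into [h_i(x, v)], exactly the two binomial coefficients that
    Pascal's rule adds up ([hsym_translate]).

    The recurrence removes a variable, so it is stated for the values [hsym] on
    a sequence, given by convolution. They agree with the sums over
    multi-indices ([chomog_hsym]) because both are the coefficient of [X^d] in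
    the product over the variables of the truncated geometric series
    [\sum_(j <= d) (x X)^j]. *)

(** The convolution [h_d(x, s) = \sum_j x^j h_(d-j)(s)] sorts the monomials of
    the complete homogeneous polynomial by their degree in the first variable. *)
Fixpoint hsym (R : comNzRingType) (s : seq R) (d : nat) : R :=
  if s is x :: s' then \sum_(j < d.+1) x ^+ j * hsym R s' (d - j)
  else (d == 0%N)%:R.
Arguments hsym {R} s d.

Lemma hsym0 (R : comNzRingType) (s : seq R) : hsym s 0 = 1.
Proof. by elim: s => //= x s IH; rewrite big_ord1 mul1r IH. Qed.

Lemma hsym_rec (R : comNzRingType) (x : R) (s : seq R) (d : nat) :
  hsym (x :: s) d.+1 = hsym s d.+1 + x * hsym (x :: s) d.
Proof.
rewrite /= big_ord_recl mul1r subn0; congr (_ + _).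
by rewrite mulr_sumr; apply: eq_bigr => j _; rewrite exprS mulrA.
Qed.

(* Simplification must not unfold the convolution from here on. *)
Arguments hsym : simpl never.

(** In the empty case the predecessor matters only for [d = 0], where the
    truncated [(0 + 0).-1 = 0] gives the correct value ['C(0, 0) = 1]; for
    [d > 0] the coefficient ['C(d - 1, d)] of [h_0] vanishes as it should. *)
Lemma hsym_translate (R : comNzRingType) (xi : R) (s : seq R) (d : nat) :
  hsym [seq x + xi | x <- s] d =
  \sum_(i < d.+1) 'C((d + size s).-1, d - i)%:R * xi ^+ (d - i) * hsym s i.
Proof.
elim: s d => [|x s IHs] d.
  rewrite /hsym big_ord_recl /= mulr1 big1 => [|i _]; last by rewrite mulr0.
  rewrite addr0 addn0 subn0; case: d => [|d] /=; first by rewrite mulr1.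
  by rewrite bin_small // mul0r.
elim: d => [|d IHd]; first by rewrite big_ord1 !hsym0 !mulr1 bin0.
rewrite [map _ _]/= hsym_rec IHs -[(x + xi) :: _]/(map _ (x :: s)) IHd.
rewrite /size -/(size s) addSn !addnS !succnK.
set n := (d + size s)%N; set B := (X in (x + xi) * X).
(* The terms multiplied by x turn each h_i(s) into h_i(x, s). *)
have absorb : \sum_(i < d.+2) 'C(n, d.+1 - i)%:R * xi ^+ (d.+1 - i) * hsym s i
                + x * B
    = \sum_(i < d.+2) 'C(n, d.+1 - i)%:R * xi ^+ (d.+1 - i) * hsym (x :: s) i.
  rewrite big_ord_recl [RHS]big_ord_recl !hsym0 -addrA; congr (_ + _).
  rewrite mulr_sumr -big_split; apply: eq_bigr => i _.
  by rewrite lift0 hsym_rec subSS /=; ring.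
rewrite mulrDl addrA absorb big_ord_recr [RHS]big_ord_recr /= subnn !bin0.
rewrite addrAC mulr_sumr -big_split; congr (_ + _); apply: eq_bigr => i _.
have leid : (i <= d)%N by rewrite -ltnS.
by rewrite subSn // binS natrD exprS /=; ring.
Qed.

(** Terms of the geometric series beyond degree [d] do not reach the coefficient
    of [X^d], so any truncation order [D >= d] gives the same value. *)
Lemma coef_prod_geom (R : comNzRingType) (D : nat) (s : seq R) (d : nat) :
  (d <= D)%N ->
  (\prod_(x <- s) \sum_(j < D.+1) x ^+ j *: 'X^j)`_d = hsym s d.
Proof.
elim: s d => [|x s IH] d led; first by rewrite big_nil coef1.
rewrite big_cons coefM; apply: eq_bigr => j _.
rewrite -(poly_def D.+1 (fun i => x ^+ i)) coef_poly.
have lejd : (j <= d)%N by rewrite -ltnS.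
rewrite ltnS (leq_trans lejd led) IH //.
exact: leq_trans (leq_subr _ _) led.
Qed.

(** Expanding the product of truncated geometric series yields one monomial
    [v ^ w X^|w|] for each bounded multi-index [w]. *)
Lemma chomog_hsym (R : realType) (m d : nat) (v : 'rV[R]_m) :
  chomog d v = hsym [seq v ord0 i | i <- enum 'I_m] d.
Proof.
rewrite -(@coef_prod_geom R d) // big_map big_enum /= bigA_distr_bigA.
rewrite coef_sum /chomog big_mkcond; apply: eq_bigr => w _.
rewrite scaler_prod prodrXr coefZ coefXn eq_sym -/(mabs w) -/(mpow v w).
by case: eqP; rewrite ?mulr1 ?mulr0.
Qed.

Lemma chomog_translate (R : realType) (m d : nat) (v : 'rV[R]_m) (xi : R) :
  chomog d (v + const_mx xi) =
  \sum_(i < d.+1) 'C((d + m).-1, d - i)%:R * xi ^+ (d - i) * chomog i v.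
Proof.
rewrite chomog_hsym (eq_map (g := (fun x => x + xi) \o v ord0)); last first.
  by move=> i; rewrite !mxE.
rewrite map_comp hsym_translate size_map size_enum_ord.
by apply: eq_bigr => i _; rewrite chomog_hsym.
Qed.

Theorem lemma3p3 (R : realType) (k r : nat) (J : 'I_r.+1 -> nat)
    (J0 : J ord0 = 0%N)
    (J_incr : forall a b : 'I_r.+1, (a < b)%N -> (J a < J b)%N)
    (n : nat) (n_def : n = (J ord_max + k + 1)%N)
    (t : nat -> R)
    (t_ndecr : forall a b : nat, (a <= b)%N -> (b <= n)%N -> t a <= t b)
    (xi : R) :
  Mmat_shift k J t xi = Pmat k r xi *m Mmat k J t.
Proof.
apply/matrixP => d l; rewrite !mxE chomog_translate !addnS succnK.
rewrite (big_ord_widen r.+1 (fun i => 'C((d + k).+1, d - i)%:R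
  * xi ^+ (d - i) * chomog i (window k t (J l)))) // big_mkcond.
apply: eq_bigr => i _; rewrite !mxE ltnS addn1.
by case: ifP => _; rewrite ?mul0r.
Qed.
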